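(* Let $(X,\Sigma,\lambda)$ be a positive measure space such that $L_1(X)^*=L_\infty(X)$ in the canonical way, and let $f\in L_1(X)$. Then $f$ is a left-symmetric point of $L_1(X)$ if and only if exactly one of the following conditions holds: (1) $f\equiv0$ (i.e. $f=0$ almost everywhere). (2) $f\not\equiv0$ and $\Sigma=\{\emptyset,X\}$ up to $\lambda$-null sets, i.e. every $E\in\Sigma$ satisfies $\lambda(E)=0$ or $\lambda(X\setminus E)=0$. (3) $f\not\equiv0$ and there exist disjoint atoms $A,B\in\Sigma$ such that $A\sqcup B=X$ and $\lambda(A)|f(x)|=\lambda(B)|f(y)|$ for almost every $x\in A$ and almost every $y\in B$.
   Context: $\mathbb{K}$ is $\mathbb{R}$ or $\mathbb{C}$; $L_1(X)$ and $L_\infty(X)$ are the usual spaces of $\mathbb{K}$-valued functions (modulo a.e. equality) on $(X,\Sigma,\lambda)$. ''$L_1(X)^*=L_\infty(X)$ in the canonical way'' means that the map sending $h\in L_\infty(X)$ to the functional $f\mapsto\int_X hf\,d\lambda$ is an isometric isomorphism of $L_\infty(X)$ onto the continuous dual $L_1(X)^*$. A set $A\in\Sigma$ is an atom if $\lambda(A)>0$ and for every $B\in\Sigma$ with $B\subset A$ and $\lambda(B)>0$ one has $\lambda(A\setminus B)=0$. $\sqcup$ denotes disjoint union. In a normed space $\mathbb{X}$ over $\mathbb{K}$, $x\perp_B y$ (Birkhoff-James orthogonality) means $\|x+\alpha y\|\ge\|x\|$ for all $\alpha\in\mathbb{K}$; $x\in\mathbb{X}$ is left-symmetric if $x\perp_B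 y$ implies $y\perp_B x$ for every $y\in\mathbb{X}$. *)

(* Defs.v *)
From HB Require Import structures.
From mathcomp Require Import all_boot all_order all_algebra.
From mathcomp Require Import complex.
From mathcomp Require Import all_classical all_reals all_analysis.
From mathcomp Require Import measurable_realfun ess_sup_inf ring_quotient.

Set Implicit Arguments.
Unset Strict Implicit.
Unset Printing Implicit Defensive.
Import Order.TTheory GRing.Theory Num.Theory.
Import numFieldNormedType.Exports.
Local Open Scope classical_set_scope.
Local Open Scope ring_scope.
Local Open Scope quotient_scope.

Section scalars.
Variable R : realType.

Variant scalar_kind := RealScalars | ComplexScalars.

Definition scalar (s : scalar_kind) : numFieldType :=
  match s with RealScalars => R | ComplexScalars => R[i] end.

Definition scalar_re (s : scalar_kind) : scalar s -> R :=
  match s with RealScalars => id | ComplexScalars => @complex.Re R end.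

Definition scalar_im (s : scalar_kind) : scalar s -> R :=
  match s with RealScalars => fun=> 0 | ComplexScalars => @complex.Im R end.

(* [mk_scalar a b] is a + ib, the imaginary part being dropped over the reals *)
Definition mk_scalar (s : scalar_kind) : R -> R -> scalar s :=
  match s with RealScalars => fun a _ => a | ComplexScalars => @Complex R end.

(* the norm of a numFieldType takes its values in the field itself; this is
   the same number, seen in R *)
Definition modulus (s : scalar_kind) (z : scalar s) : R := scalar_re `|z|.

End scalars.

Section scalar_theory.
Variables (R : realType) (s : scalar_kind).
Implicit Types x y z : scalar R s.

Lemma modulusE z : mk_scalar s (modulus z) 0 = `|z|.
Proof. by case: s z => // z; rewrite /modulus normc_def. Qed.

Lemma modulus_def z :
  modulus z = Num.sqrt (scalar_re z ^+ 2 + scalar_im z ^+ 2).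
Proof.
case: s z => [z|[a b]]; rewrite /modulus /=; last by [].
by rewrite expr0n/= addr0 sqrtr_sqr.
Qed.

Lemma modulus_ge0 z : 0 <= modulus z.
Proof. by rewrite modulus_def sqrtr_ge0. Qed.

Lemma mk_scalar_inj : injective ((mk_scalar s)^~ (0 : R)).
Proof. by case: s => [//|] a b [->]. Qed.

Lemma mk_scalar_le (a b : R) :
  (mk_scalar s a 0 <= mk_scalar s b 0) = (a <= b).
Proof. by case: s => //=; exact: lecR. Qed.

Lemma mk_scalarD (a b : R) :
  mk_scalar s (a + b) 0 = mk_scalar s a 0 + mk_scalar s b 0.
Proof. by case: s => //=; rewrite -[LHS]/((a + b)%:C%C) rmorphD. Qed.

Lemma mk_scalarM (a b : R) :
  mk_scalar s (a * b) 0 = mk_scalar s a 0 * mk_scalar s b 0.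
Proof. by case: s => //=; rewrite -[LHS]/((a * b)%:C%C) rmorphM. Qed.

Lemma mk_scalar0 : mk_scalar s 0 0 = 0 :> scalar R s.
Proof. by case: s. Qed.

Lemma modulusD x y : modulus (x + y) <= modulus x + modulus y.
Proof. by rewrite -mk_scalar_le mk_scalarD !modulusE ler_normD. Qed.

Lemma modulusM x y : modulus (x * y) = modulus x * modulus y.
Proof. by apply: mk_scalar_inj; rewrite mk_scalarM !modulusE normrM. Qed.

Lemma modulus_eq0 x : (modulus x == 0) = (x == 0).
Proof.
by rewrite -(inj_eq mk_scalar_inj) modulusE mk_scalar0 normr_eq0.
Qed.

Lemma scalar_reP a x y : scalar_re (a * x + y) =
  scalar_re a * scalar_re x - scalar_im a * scalar_im x + scalar_re y.
Proof.
case: s a x y => [a x y|[a b] [c d] [e f]] //=.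
by rewrite mul0r subr0.
Qed.

Lemma scalar_imP a x y : scalar_im (a * x + y) =
  scalar_re a * scalar_im x + scalar_im a * scalar_re x + scalar_im y.
Proof.
case: s a x y => [a x y|[a b] [c d] [e f]] //=.
by rewrite mulr0 mul0r !addr0.
Qed.

Lemma scalar_re0 : scalar_re (0 : scalar R s) = 0. Proof. by case: s. Qed.

Lemma scalar_im0 : scalar_im (0 : scalar R s) = 0. Proof. by case: s. Qed.

End scalar_theory.

Section measurable_functions.
Context d (T : measurableType d) (R : realType) (s : scalar_kind).
Local Notation K := (scalar R s).

(* measurability of the real and imaginary parts, i.e. Borel measurability *)
Definition scalar_measurable : {pred T -> K^o} :=
  mem [set f : T -> K^o | measurable_fun setT (@scalar_re R s \o f) /\
                          measurable_fun setT (@scalar_im R s \o f)].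

Lemma scalar_measurable_submod : submod_closed scalar_measurable.
Proof.
split.
  apply: mem_set; split.
    rewrite [X in measurable_fun _ X](_ : _ = cst 0)//.
    by apply/funext => x; exact: scalar_re0.
  rewrite [X in measurable_fun _ X](_ : _ = cst 0)//.
  by apply/funext => x; exact: scalar_im0.
move=> a f g /set_mem[rf jf] /set_mem[rg jg]; apply: mem_set; split.
  rewrite [X in measurable_fun _ X](_ : _ = fun x =>
    scalar_re a * scalar_re (f x) - scalar_im a * scalar_im (f x)
      + scalar_re (g x)); last by apply/funext => x; exact: scalar_reP.
  by apply: measurable_funD => //; apply: measurable_funB;
    exact: measurable_funM.
rewrite [X in measurable_fun _ X](_ : _ = fun x =>
  scalar_re a * scalar_im (f x) + scalar_im a * scalar_re (f x)
    + scalar_im (g x)); last by apply/funext => x; exact: scalar_imP.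
by apply: measurable_funD => //; apply: measurable_funD; exact: measurable_funM.
Qed.

HB.instance Definition _ := GRing.isSubmodClosed.Build K (T -> K^o)
  scalar_measurable scalar_measurable_submod.

Record mfunK := MfunK {
  mfunK_fun :> T -> K^o ;
  mfunK_measurable : mfunK_fun \in scalar_measurable }.

HB.instance Definition _ := [isSub for mfunK_fun].
HB.instance Definition _ := [Choice of mfunK by <:].
HB.instance Definition _ := [SubChoice_isSubLmodule of mfunK by <:].

Lemma measurable_modulus (f : mfunK) :
  measurable_fun setT (@modulus R s \o f).
Proof.
have /set_mem[mre mim] := mfunK_measurable f.
rewrite [X in measurable_fun _ X](_ : _ = fun x =>
  Num.sqrt (scalar_re (f x) ^+ 2 + scalar_im (f x) ^+ 2)); last first.
  by apply/funext => x /=; rewrite modulus_def.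
apply: (@measurableT_comp _ _ _ _ _ _ (@Num.sqrt R)).
  by apply: continuous_measurable_fun; exact: sqrt_continuous.
by apply: measurable_funD; apply: measurable_funX.
Qed.

End measurable_functions.

Section almost_everywhere_classes.
Context d (T : measurableType d) (R : realType) (s : scalar_kind).
Variable mu : {measure set T -> \bar R}.
Local Notation K := (scalar R s).

Definition ae_null : {pred mfunK T R s} :=
  mem [set f : mfunK T R s | \forall x \ae mu, f x = 0].

Lemma ae_null_submod : submod_closed ae_null.
Proof.
split; first by apply: mem_set; exact: aeW.
move=> a f g /set_mem f0 /set_mem g0; apply: mem_set.
apply: filterS2 f0 g0 => x /= fx gx.
by rewrite -[LHS]/(a * f x + g x) fx gx mulr0 addr0.
Qed.

HB.instance Definition _ := GRing.isSubmodClosed.Build K (mfunK T R s)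
  ae_null ae_null_submod.

(* L^0: measurable K-valued functions modulo equality almost everywhere *)
Definition aeclass : Type := Quotient.quot ae_null.

HB.instance Definition _ := GRing.Zmodule.on aeclass.

Definition aeclass_of (f : mfunK T R s) : aeclass := \pi_(Quotient.quot ae_null) f.
(* a chosen representative; only its almost everywhere properties matter *)
Definition aeclass_repr (f : aeclass) : mfunK T R s :=
  repr (f : (Quotient.quot ae_null)).
Coercion aeclass_repr : aeclass >-> mfunK.

Lemma aeclass_reprK (f : aeclass) : aeclass_of f = f.
Proof. exact: reprK. Qed.

Lemma aeclass_ofD (f g : mfunK T R s) :
  aeclass_of (f + g) = aeclass_of f + aeclass_of g.
Proof. exact: Quotient.pi_add. Qed.

Lemma aeclass_eqP (f g : mfunK T R s) :
  aeclass_of f = aeclass_of g <-> \forall x \ae mu, f x = g x.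
Proof.
split.
  move=> /eqP; rewrite /aeclass_of -Quotient.idealrBE => /set_mem.
  by apply: filterS => x /eqP; rewrite subr_eq0 => /eqP.
move=> fg; apply/eqP; rewrite /aeclass_of -Quotient.idealrBE; apply: mem_set.
by apply: filterS fg => x fgx; apply/eqP; rewrite subr_eq0; apply/eqP.
Qed.

Definition aeclass_scale (a : K) (f : aeclass) : aeclass :=
  aeclass_of (a *: (f : mfunK T R s)).

Lemma aeclass_ofZ (a : K) (f : mfunK T R s) :
  aeclass_scale a (aeclass_of f) = aeclass_of (a *: f).
Proof.
apply/aeclass_eqP; have /aeclass_eqP := aeclass_reprK (aeclass_of f).
by apply: filterS => x fx; exact: (congr1 (fun z => a * z) fx).
Qed.

Fact aeclass_scaleA (a b : K) (f : aeclass) :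
  aeclass_scale a (aeclass_scale b f) = aeclass_scale (a * b) f.
Proof. by rewrite -[f]aeclass_reprK !aeclass_ofZ scalerA. Qed.

Fact aeclass_scale1 : left_id (1 : K) aeclass_scale.
Proof. by move=> f; rewrite -[f]aeclass_reprK aeclass_ofZ scale1r. Qed.

Fact aeclass_scaleDr : right_distributive aeclass_scale +%R.
Proof.
move=> a f g; rewrite -[f]aeclass_reprK -[g]aeclass_reprK.
by rewrite -aeclass_ofD !aeclass_ofZ -aeclass_ofD scalerDr.
Qed.

Fact aeclass_scaleDl (f : aeclass) :
  {morph aeclass_scale^~ f : a b / a + b}.
Proof.
move=> a b; rewrite -[f]aeclass_reprK !aeclass_ofZ -aeclass_ofD.
by rewrite scalerDl.
Qed.

HB.instance Definition _ := GRing.Zmodule_isLmodule.Build K aeclass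
  aeclass_scaleA aeclass_scale1 aeclass_scaleDr aeclass_scaleDl.

Lemma aeclass_reprP (a : K) (f g : aeclass) :
  \forall x \ae mu, aeclass_repr (a *: f + g) x = a * f x + g x.
Proof.
apply/(@aeclass_eqP _ (a *: (f : mfunK T R s) + (g : mfunK T R s))).
by rewrite aeclass_reprK aeclass_ofD aeclass_reprK.
Qed.

Lemma aeclass_repr0 : \forall x \ae mu, aeclass_repr (0 : aeclass) x = 0.
Proof.
have := aeclass_reprP (-1) 0 0; apply: filterS => x.
by rewrite scaler0 addr0 mulN1r addNr.
Qed.

End almost_everywhere_classes.

Section Lnorm_monotone.
Context d (T : measurableType d) (R : realType).
Variable mu : {measure set T -> \bar R}.
Local Open Scope ereal_scope.

Lemma ae_le_Lnorm (p : \bar R) (f g : T -> R) : 1 <= p ->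
  measurable_fun setT f -> measurable_fun setT g ->
  (\forall x \ae mu, (`|f x| <= `|g x|)%R) ->
  'N[mu]_p[EFin \o f] <= 'N[mu]_p[EFin \o g].
Proof.
case: p => [p| |//] p1 mf mg fg; rewrite unlock /Lnorm; last first.
  by case: ifPn => // _; apply: le_ess_sup; apply: filterS fg => x.
rewrite lee_fin in p1.
have p0 : (0 <= p)%R by exact: le_trans p1.
have mN (h : T -> R) : measurable_fun setT h ->
    measurable_fun setT (fun x => `|(EFin \o h) x| `^ p).
  move=> mh; apply: (measurableT_comp (measurable_poweR _)) => //.
  by apply: measurableT_comp => //; exact/measurable_EFinP.
apply: gt0_ler_poweR.
- by rewrite invr_ge0.
- by rewrite in_itv/= leey integral_ge0.
- by rewrite in_itv/= leey integral_ge0.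
apply: ae_ge0_le_integral => //.
- by move=> x _; exact: poweR_ge0.
- exact: mN.
- by move=> x _; exact: poweR_ge0.
- exact: mN.
apply: filterS fg => x fgx _; apply: gt0_ler_poweR => //.
- by rewrite in_itv/= leey lee_fin normr_ge0.
- by rewrite in_itv/= leey lee_fin normr_ge0.
Qed.

End Lnorm_monotone.

Section Lp_spaces.
Context d (T : measurableType d) (R : realType) (s : scalar_kind).
Variables (mu : {measure set T -> \bar R}) (p : \bar R) (p1 : (1 <= p)%E).
Local Notation K := (scalar R s).
Local Notation L0 := (aeclass s mu).

(* at p = +oo, [Lnorm] is the essential supremum *)
Definition Lp_enorm (f : L0) : \bar R :=
  'N[mu]_p[EFin \o (@modulus R s \o f)]%E.

(* the unused proof that 1 <= p lets the instances below be inferred *)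
Definition Lp_pred of (1 <= p)%E : {pred L0} := mem [set f : L0 | (Lp_enorm f < +oo)%E].

Lemma Lp_enormD (f g : L0) :
  (Lp_enorm (f + g)%R <= Lp_enorm f + Lp_enorm g)%E.
Proof.
apply: (@le_trans _ _
  'N[mu]_p[EFin \o ((@modulus R s \o f) \+ (@modulus R s \o g))%R])%E; last first.
  by apply: eminkowski => //; exact: measurable_modulus.
apply: ae_le_Lnorm => //; first exact: measurable_modulus.
  by apply: measurable_funD; exact: measurable_modulus.
have := aeclass_reprP 1 f g; apply: filterS => x; rewrite scale1r mul1r /= => ->.
by rewrite !ger0_norm ?addr_ge0 ?modulus_ge0// modulusD.
Qed.

Lemma Lp_enormZ (a : K) (f : L0) : f \in Lp_pred p1 ->
  Lp_enorm (a *: f) = ((modulus a)%:E * Lp_enorm f)%E.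
Proof.
move=> /set_mem/= ff.
have fL : (@modulus R s \o f) \in Lfun mu p.
  by rewrite inE; apply/andP; split; apply: mem_set => //;
    exact: measurable_modulus.
have := LnormZ (Lfun_Sub p1 fL) (modulus a).
rewrite ger0_norm ?modulus_ge0// => <-.
have af : \forall x \ae mu, aeclass_repr (a *: f) x = a * f x.
  have := aeclass_reprP a f 0; rewrite addr0 => afE.
  by have f0 := aeclass_repr0 s mu; apply: filterS2 afE f0 => x -> ->; rewrite addr0.
have maf : measurable_fun setT (modulus a \*: (@modulus R s \o f)).
  by apply: measurable_funM => //; exact: measurable_modulus.
apply/eqP; rewrite eq_le; apply/andP; split;
  apply: ae_le_Lnorm => //; try exact: measurable_modulus;
  by apply: filterS af => x /= ->; rewrite modulusM.
Qed.

Lemma Lp_submod : submod_closed (Lp_pred p1).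
Proof.
have Z0 : 0 \in Lp_pred p1.
  apply: mem_set => /=; apply: (@le_lt_trans _ _ 'N[mu]_p[EFin \o cst 0%R])%E.
    apply: ae_le_Lnorm => //; first exact: measurable_modulus.
    apply: filterS (aeclass_repr0 s mu) => x /= ->.
    by rewrite modulus_def scalar_re0 scalar_im0 expr0n/= addr0 sqrtr0.
  by rewrite Lnorm0// gt_eqF// (lt_le_trans _ p1).
split=> // a f g fL gL; apply: mem_set => /=.
apply: le_lt_trans (Lp_enormD _ _) _; rewrite lte_add_pinfty//; last first.
  exact: set_mem gL.
rewrite Lp_enormZ// lte_mul_pinfty ?lee_fin ?modulus_ge0//.
exact: set_mem fL.
Qed.

HB.instance Definition _ := GRing.isSubmodClosed.Build K L0 (Lp_pred p1) Lp_submod.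

Record Lp := MkLp { Lp_class :> L0 ; Lp_classP : Lp_class \in Lp_pred p1 }.

HB.instance Definition _ := [isSub for Lp_class].
HB.instance Definition _ := [Choice of Lp by <:].
HB.instance Definition _ := [SubChoice_isSubLmodule of Lp by <:].

Definition Lp_norm (f : Lp) : K := mk_scalar s (fine (Lp_enorm f)) 0.

Lemma Lp_enorm_fine (f : Lp) : (fine (Lp_enorm f))%:E = Lp_enorm f.
Proof.
rewrite fineK// ge0_fin_numE; first exact: set_mem (Lp_classP f).
exact: Lnorm_ge0.
Qed.

Fact Lp_normD (f g : Lp) : Lp_norm (f + g) <= Lp_norm f + Lp_norm g.
Proof.
rewrite -mk_scalarD mk_scalar_le -lee_fin EFinD !Lp_enorm_fine.
exact: Lp_enormD.
Qed.

Fact Lp_normZ (a : K) (f : Lp) : Lp_norm (a *: f) = `|a| * Lp_norm f.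
Proof.
rewrite -modulusE -mk_scalarM; congr mk_scalar; apply: EFin_inj.
by rewrite EFinM !Lp_enorm_fine Lp_enormZ// Lp_classP.
Qed.

Fact Lp_norm_eq0 (f : Lp) : Lp_norm f = 0 -> f = 0.
Proof.
rewrite /Lp_norm -[RHS](mk_scalar0 R s) => /mk_scalar_inj f0.
have {}f0 : Lp_enorm f = 0%E by rewrite -Lp_enorm_fine f0.
have {}f0 : \forall x \ae mu, f x = 0.
  have mf : measurable_fun setT (EFin \o (@modulus R s \o f)).
    by apply/measurable_EFinP; exact: measurable_modulus.
  have := Lnorm_eq0_eq0 mf (lt_le_trans lte01 p1) f0.
  apply: filterS => x /(_ I)[] /eqP; rewrite modulus_eq0.
  by move/eqP.
apply: val_inj => /=; rewrite -[LHS]aeclass_reprK -[RHS]aeclass_reprK.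
apply/aeclass_eqP; apply: filterS2 f0 (aeclass_repr0 s mu) => x.
by move=> -> ->.
Qed.

HB.instance Definition _ := @Lmodule_isNormed.Build K Lp Lp_norm
  Lp_normD Lp_normZ Lp_norm_eq0.

End Lp_spaces.

Section spaces_L1_Linfty.
Context d (T : measurableType d) (R : realType) (s : scalar_kind).
Variable mu : {measure set T -> \bar R}.
Local Notation K := (scalar R s).

Definition L1 := Lp s mu (lexx 1%E).
Definition Linfty := Lp s mu (leey 1%E).

Lemma L1_normE (f : L1) :
  `|f| = mk_scalar s (\int[mu]_x modulus (f x)) 0.
Proof.
rewrite -[LHS]/(Lp_norm f) /Lp_norm /Lp_enorm Lnorm1; congr (mk_scalar s _ 0).
congr fine; apply: eq_integral => x _ /=.
by rewrite ger0_norm ?modulus_ge0.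
Qed.

Definition scalar_integral (g : T -> K) : K :=
  mk_scalar s (\int[mu]_x scalar_re (g x)) (\int[mu]_x scalar_im (g x)).

Definition canonical_pairing (h : Linfty) (f : L1) : K^o :=
  scalar_integral (fun x => h x * f x).

End spaces_L1_Linfty.

Section duality.
Context (R : realType) (s : scalar_kind).
Local Notation K := (scalar R s).

Definition continuous_dual (V : normedModType K) : set (V -> K^o) :=
  [set phi | linear phi /\ continuous phi].

Definition dual_norm (V : normedModType K) (phi : V -> K^o) : R :=
  (* [sup] is the supremum whenever the set is bounded, i.e. phi is continuous *)
  sup [set modulus (phi v) | v in [set v : V | `|v| <= 1]].

Definition isometric_isomorphism_onto_dual (U V : normedModType K)
    (Phi : U -> (V -> K^o)) : Prop :=
  [/\ linear Phi, set_bij [set: U] (@continuous_dual V) Phi &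
      forall u : U, dual_norm (Phi u) = scalar_re `|u|].

End duality.

Definition L1_dual_is_Linfty d (T : measurableType d) (R : realType)
    (s : scalar_kind) (mu : {measure set T -> \bar R}) : Prop :=
  isometric_isomorphism_onto_dual (@canonical_pairing d T R s mu).

Definition birkhoff_james (K : numFieldType) (V : normedModType K)
    (x y : V) : Prop :=
  forall a : K, `|x| <= `|x + a *: y|.

Definition left_symmetric (K : numFieldType) (V : normedModType K)
    (x : V) : Prop :=
  forall y : V, birkhoff_james x y -> birkhoff_james y x.

Definition atom d (T : measurableType d) (R : realType)
    (mu : {measure set T -> \bar R}) (A : set T) : Prop :=
  [/\ measurable A, (0 < mu A)%E &
      forall B, measurable B -> B `<=` A -> (0 < mu B)%E ->
        mu (A `\` B) = 0%E].

Definition exactly_one (P Q S : Prop) : Prop :=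
  [\/ [/\ P, ~ Q & ~ S], [/\ ~ P, Q & ~ S] | [/\ ~ P, ~ Q & S]].

(* Main.v *)
Require Import Defs.
From mathcomp Require Import all_boot all_order all_algebra.
From mathcomp Require Import complex ring lra.
From mathcomp Require Import all_classical all_reals all_analysis.
From mathcomp Require Import measurable_realfun ess_sup_inf.

(** Call [u] and [v] an l1-sum when [`|a u + b v| = `|a| `|u| + `|b| `|v|] for
    all scalars; two functions of L1 with disjoint supports form one
    ([l1_sum_disjoint]).  Both directions of the theorem reduce to elementary
    computations with l1-sums.  Birkhoff-James orthogonality is written [_|_].

    Let [f <> 0] be left-symmetric.  If [z <> 0] and [f], [z] form an l1-sum,
    then [y := f + (`|f| / `|z|) z] satisfies [f _|_ y], but [`|y - f| = `|f|]
    is half of [`|y|]: so no such [z] exists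
    ([left_symmetric_l1_sum_eq0]).  If instead [f = u + v] is an l1-sum of
    nonzero parts, then [y := u / `|u| - v / `|v|] satisfies [f _|_ y], and
    [y _|_ f] forces [`|u| = `|v|] ([left_symmetric_l1_sum]).

    In L1, duality with Linfty makes every non-null set carry a nonzero
    integrable function, since otherwise its indicator would pair to zero with
    everything ([L1_dual_support]).  The first fact then says that [f] vanishes
    almost nowhere; the second, applied to the restrictions of [f] to [E] and
    to its complement, says that any two complementary non-null sets have the
    same mass for the finite measure with density [|f|].  Splitting [E]
    further would produce complementary sets with different masses, so if the
    sigma-algebra is not trivial, [E] and its complement are two atoms of equal
    mass ([left_symmetric_atom]).

    Conversely, measurable functions are almost everywhere constant on atoms
    ([atom_ae_const]).  When the sigma-algebra is trivial, L1 is the line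
    spanned by [f], and [f _|_ y] holds only for [y = 0].  When there are two
    atoms of equal mass, L1 is the span of an l1-sum [u], [v] with [f = u + v]
    and [`|u| = `|v|]; there the parallelogram law of the scalars shows that
    [f _|_ y] only for the multiples [y] of [u - v], for which [y _|_ f] is
    the triangle inequality ([left_symmetric_l1_span]). *)

Set Implicit Arguments.
Unset Strict Implicit.
Unset Printing Implicit Defensive.
Import Order.TTheory GRing.Theory Num.Theory.
Import numFieldNormedType.Exports.
Local Open Scope classical_set_scope.
Local Open Scope ring_scope.

(** * Left-symmetric points and l1-sums in normed spaces *)

Section normed.
Variables (K : numFieldType) (V : normedModType K).
Implicit Types (u v f z : V).

Definition l1_sum u v : Prop :=
  forall a b : K, `|a *: u + b *: v| = `|a| * `|u| + `|b| * `|v|.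

Lemma l1_sumC u v : l1_sum u v -> l1_sum v u.
Proof. by move=> uv a b; rewrite addrC uv addrC. Qed.

Lemma l1_sum_normD u v : l1_sum u v -> `|u + v| = `|u| + `|v|.
Proof. by move=> /(_ 1 1); rewrite !scale1r normr1 !mul1r. Qed.

Lemma birkhoff_james0l f : birkhoff_james 0 f.
Proof. by move=> a; rewrite normr0. Qed.

Lemma left_symmetric0 : left_symmetric (0 : V).
Proof. by move=> y _ a; rewrite scaler0 addr0. Qed.

(** The witness [y = f + k z], with [k] chosen so that [`|k z| = `|f|], gives
    [`|f + a y| = (`|1 + a| + `|a|) `|f| >= `|f|], while subtracting [f] from
    [y] leaves [k z] and halves the norm. *)
Lemma left_symmetric_l1_sum_eq0 f z :
  l1_sum f z -> z != 0 -> left_symmetric f -> f = 0.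
Proof.
move=> fz z0 symf; have zn0 : `|z| != 0 by rewrite normr_eq0.
pose k := `|f| / `|z|.
have k0 : 0 <= k by rewrite divr_ge0.
have kz : k * `|z| = `|f| by rewrite divfK.
have fy : birkhoff_james f (f + k *: z).
  move=> a; rewrite scalerDr scalerA addrA -{2}[f]scale1r -scalerDl fz.
  rewrite normrM (ger0_norm k0) -mulrA kz -mulrDl ler_peMl//.
  by have := ler_normB (1 + a) a; rewrite addrK normr1.
have := symf _ fy (-1).
rewrite scaleN1r addrAC subrr add0r normrZ (ger0_norm k0) kz.
rewrite -{1}[f]scale1r fz normr1 mul1r (ger0_norm k0) kz gerDl normr_le0.
by move/eqP.
Qed.

(** With [y = u / `|u| - v / `|v|], the norm of [f + a y] is
    [`| `|u| + a| + `| `|v| - a| >= `|u| + `|v|], so [f _|_ y].  Cancelling the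
    [u]-part of [y] by the multiple [- `|u|^-1] of [f] leaves norm
    [1 + `|v| / `|u|], to be compared with [`|y| = 2]. *)
Lemma left_symmetric_l1_sum_le u v :
  l1_sum u v -> u != 0 -> v != 0 -> left_symmetric (u + v) -> `|u| <= `|v|.
Proof.
move=> uv u0 v0 symf; set f := u + v in symf.
have pn0 : `|u| != 0 by rewrite normr_eq0.
have qn0 : `|v| != 0 by rewrite normr_eq0.
have p0 : 0 < `|u| by rewrite normr_gt0.
pose y := `|u|^-1 *: u - `|v|^-1 *: v.
have fy : birkhoff_james f y.
  move=> a.
  have -> : f + a *: y = (1 + a / `|u|) *: u + (1 - a / `|v|) *: v.
    by rewrite scalerBr !scalerA scalerDl scalerBl !scale1r addrACA.
  rewrite (l1_sum_normD uv) uv.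
  have := ler_normD (`|u| + a) (`|v| - a).
  rewrite addrACA subrr addr0 (ger0_norm (addr_ge0 _ _))//.
  have <- : `|1 + a / `|u| | * `|u| = `| `|u| + a|.
    by rewrite -{2}(normr_id u) -normrM mulrDl mul1r divfK.
  have <- // : `|1 - a / `|v| | * `|v| = `| `|v| - a|.
  by rewrite -{2}(normr_id v) -normrM mulrBl mul1r divfK.
have := symf _ fy (- `|u|^-1).
have -> : y + (- `|u|^-1) *: f = 0 *: u + (- (`|v|^-1 + `|u|^-1)) *: v.
  rewrite scale0r add0r !scaleNr scalerDr opprD addrACA subrr add0r.
  by rewrite -opprD -scalerDl.
have -> : y = `|u|^-1 *: u + (- `|v|^-1) *: v by rewrite scaleNr.
rewrite !uv normr0 mul0r add0r !normrN ger0_norm ?addr_ge0 ?invr_ge0//.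
rewrite !ger0_norm ?invr_ge0// !mulVf// mulrDl mulVf// lerD2l.
by rewrite ler_pdivlMl// mulr1.
Qed.

Lemma left_symmetric_l1_sum u v :
  l1_sum u v -> u != 0 -> v != 0 -> left_symmetric (u + v) -> `|u| = `|v|.
Proof.
move=> uv u0 v0 symf; apply/eqP; rewrite eq_le.
rewrite left_symmetric_l1_sum_le//=.
by apply: (left_symmetric_l1_sum_le (l1_sumC uv)); rewrite // addrC.
Qed.

(** If [f _|_ c f] with [c <> 0], then the multiple [- c^-1] of [c f] cancels
    [f], so [f = 0]. *)
Lemma left_symmetric_line f : (forall y, exists c, y = c *: f) ->
  left_symmetric f.
Proof.
move=> spanf y; have [c ->] := spanf y => fy.
have [-> a|c0] := eqVneq c 0; first by rewrite scale0r normr0.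
have := fy (- c^-1).
rewrite scalerA mulNr mulVf// scaleN1r subrr normr0 normr_le0 => /eqP ->.
by rewrite scaler0; exact: birkhoff_james0l.
Qed.

(** For [y = p u + q v] with [w := (p + q) / 2 <> 0], moving from [f] along
    [- (t / w) y] turns the coordinates of [f] into [1 - t - t e] and
    [1 - t + t e]; by the parallelogram law the sum of their moduli is at most
    [2 sqrt ((1 - t)^2 + t^2 `|e|^2)], which is below 2 for small [t]; here
    [e := (p - q) / (2 w)].  Hence [f _|_ y] forces [p = - q]. *)
Lemma left_symmetric_l1_span u v :
  (forall x y : K,
    `|x + y| ^+ 2 + `|x - y| ^+ 2 = 2 * (`|x| ^+ 2 + `|y| ^+ 2)) ->
  l1_sum u v -> `|u| = `|v| ->
  (forall y, exists p q : K, y = p *: u + q *: v) -> left_symmetric (u + v).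
Proof.
move=> parallelogram uv ruv span y; have [p [q ->]] := span y => fy.
have [u0|u0] := eqVneq `|u| 0.
  have v0 := u0; rewrite ruv in v0; move/eqP: u0; move/eqP: v0.
  rewrite !normr_eq0 => /eqP -> /eqP ->; rewrite !scaler0 addr0.
  exact: birkhoff_james0l.
have r0 : 0 < `|u| by rewrite lt_def u0/=.
have lincomb a b a' b' c : a *: u + b *: v + c *: (a' *: u + b' *: v) =
    (a + c * a') *: u + (b + c * b') *: v.
  by rewrite scalerDr !scalerA addrACA -!scalerDl.
have pq : p = - q.
  apply/eqP; rewrite -addr_eq0; apply/negP => /negP w0.
  pose w := (p + q) / 2; pose e := (p - q) / 2 / w.
  have wn0 : w != 0 by rewrite mulf_neq0// invr_neq0// pnatr_eq0.
  (* the minimiser of (1 - t)^2 + t^2 |e|^2, whose minimum is 1 - t *)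
  pose t : K := (1 + `|e| ^+ 2)^-1.
  have D0 : 0 < 1 + `|e| ^+ 2 by rewrite ltr_pwDl// exprn_ge0.
  have t0 : 0 < t by rewrite invr_gt0.
  have t1 : t <= 1 by rewrite invf_le1// lerDl exprn_ge0.
  have := fy (- (t / w)); rewrite (l1_sum_normD uv).
  rewrite -[X in X + _ + _]scale1r -[X in _ + X + _]scale1r lincomb uv -ruv.
  rewrite -mulrDl -mulr2n -[leLHS]mulr_natl.
  have -> : 1 + - (t / w) * p = (1 - t) - t * e.
    have -> : p = w + e * w by rewrite divfK// /w; field.
    by field.
  have -> : 1 + - (t / w) * q = (1 - t) + t * e.
    have -> : q = w - e * w by rewrite divfK// /w; field.
    by field.
  rewrite ler_pM2r//.
  set x := 1 - t; set h := t * e => xh.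
  have nh : `|h| = t * `|e| by rewrite normrM (ger0_norm (ltW t0)).
  have nx : `|x| = 1 - t by rewrite ger0_norm// subr_ge0.
  have tE : t * `|e| ^+ 2 = 1 - t.
    apply/(canRL (addrK t)); rewrite addrC -{1}[t]mulr1 -mulrDr.
    by rewrite mulVf// gt_eqF.
  have sumsq : `|x + h| ^+ 2 + `|x - h| ^+ 2 = 2 * (1 - t).
    rewrite parallelogram nx nh; congr (2 * _).
    by rewrite exprMn [t ^+ 2]expr2 -mulrA tE; ring.
  have absr : `|x - h| - `|x + h| \is Num.real by rewrite realB// normr_real.
  have := exprn_ge0 2 (normr_ge0 (`|x - h| - `|x + h|)).
  rewrite real_normK// => sqd.
  have : 2 ^+ 2 <= (`|x - h| + `|x + h|) ^+ 2.
    by rewrite lerXn2r// nnegrE ?ler0n// addr_ge0.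
  have -> : (`|x - h| + `|x + h|) ^+ 2 =
      2 ^+ 2 - 2 ^+ 2 * t - (`|x - h| - `|x + h|) ^+ 2.
    transitivity (2 * (2 * (1 - t)) - (`|x - h| - `|x + h|) ^+ 2); last by ring.
    by rewrite -sumsq; ring.
  rewrite -addrA lerDl -opprD oppr_ge0 => /le_gtF/negP; apply.
  by rewrite ltr_pwDl// mulr_gt0// exprn_gt0// ltr0n.
move=> a; rewrite scalerDr addrACA -!scalerDl !uv -ruv -!mulrDl ler_pM2r//.
rewrite pq normrN -mulr2n -normrMn [leRHS]addrC.
by have := ler_normB (q + a) (- q + a); rewrite opprD opprK addrACA subrr addr0.
Qed.
End normed.

Section scalars.
Variables (R : realType) (s : scalar_kind).
Local Notation K := (Defs.scalar R s).

Lemma scalar_parallelogram (x y : K) :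
  `|x + y| ^+ 2 + `|x - y| ^+ 2 = 2 * (`|x| ^+ 2 + `|y| ^+ 2).
Proof.
case: s x y => /= x y; first by rewrite !real_normK ?num_real//; ring.
suff C (C : numClosedFieldType) (z w : C) :
    `|z + w| ^+ 2 + `|z - w| ^+ 2 = 2 * (`|z| ^+ 2 + `|w| ^+ 2).
  exact: (C R[i] x y).
by rewrite !normCK !(rmorphB, rmorphD) /=; ring.
Qed.

End scalars.

(** * Elements of Lp and of L1 *)

Section L1_space.
Context d (X : measurableType d) (R : realType) (s : scalar_kind).
Variable mu : {measure set X -> \bar R}.
Local Notation K := (Defs.scalar R s).
Local Notation L := (L1 s mu).
Implicit Types (u v f : L) (P Q : set X).

Lemma Lp_repr_comb p (p1 : (1 <= p)%E) (a b : K) (u v : Lp s mu p1) :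
  \forall x \ae mu, (a *: u + b *: v : Lp s mu p1) x = a * u x + b * v x.
Proof.
have := aeclass_reprP a (Lp_class u) (b *: Lp_class v).
have := aeclass_reprP b (Lp_class v) 0.
have := aeclass_repr0 s mu; rewrite addr0.
by apply: filterS3 => x -> /= -> ->; rewrite addr0.
Qed.

Lemma Lp_repr0 p (p1 : (1 <= p)%E) :
  \forall x \ae mu, (0 : Lp s mu p1) x = 0.
Proof. exact: aeclass_repr0. Qed.

Lemma Lp_eqP p (p1 : (1 <= p)%E) (u v : Lp s mu p1) :
  u = v <-> \forall x \ae mu, u x = v x.
Proof.
split=> [-> |uv]; first exact: aeW.
apply: val_inj => /=; rewrite -[LHS]aeclass_reprK -[RHS]aeclass_reprK.
exact/aeclass_eqP.
Qed.

Lemma Lp_eq0P p (p1 : (1 <= p)%E) (u : Lp s mu p1) :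
  u = 0 <-> \forall x \ae mu, u x = 0.
Proof.
rewrite Lp_eqP; have u0 := Lp_repr0 p1.
by split=> uz; apply: filterS2 uz u0 => x -> ->.
Qed.

Lemma measurable_modulus_ereal (g : mfunK X R s) P :
  measurable_fun P (EFin \o (fun x => modulus (g x))).
Proof.
apply: measurable_funTS; apply/measurable_EFinP; exact: measurable_modulus.
Qed.

Lemma Lp_intro p (p1 : (1 <= p)%E) (g : mfunK X R s) :
  ('N[mu]_p[EFin \o (@modulus R s \o g)] < +oo)%E ->
  exists u : Lp s mu p1, \forall x \ae mu, u x = g x.
Proof.
move=> gfin; have gE : \forall x \ae mu, aeclass_of mu g x = g x.
  by apply/aeclass_eqP; rewrite aeclass_reprK.
suff uP : aeclass_of mu g \in Lp_pred p1 by exists (MkLp uP).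
apply: mem_set => /=; apply: le_lt_trans gfin.
apply: ae_le_Lnorm => //; try exact: measurable_modulus.
by apply: filterS gE => x /= ->.
Qed.

Lemma scalar_measurable_restrict (g : mfunK X R s) P : measurable P ->
  exists h : mfunK X R s, forall x, h x = if x \in P then g x else 0.
Proof.
move=> mP; have /set_mem[mre mim] := mfunK_measurable g.
suff hP : (fun x => if x \in P then g x else 0) \in @scalar_measurable _ X R s.
  by exists (MfunK hP).
apply: mem_set; split.
  rewrite [X in measurable_fun _ X](_ : _ = (@scalar_re R s \o g) \_ P).
    by apply/measurable_restrict => //; exact: measurable_funTS.
  by apply/funext => x /=; rewrite /patch; case: ifP => // _; exact: scalar_re0.
rewrite [X in measurable_fun _ X](_ : _ = (@scalar_im R s \o g) \_ P).
  by apply/measurable_restrict => //; exact: measurable_funTS.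
by apply/funext => x /=; rewrite /patch; case: ifP => // _; exact: scalar_im0.
Qed.

Lemma Lp_restrict p (p1 : (1 <= p)%E) (f : Lp s mu p1) P : measurable P ->
  exists u : Lp s mu p1,
    \forall x \ae mu, u x = if x \in P then f x else 0.
Proof.
move=> mP; have [h hE] := scalar_measurable_restrict f mP.
have [|u uE] := Lp_intro p1 (g := h).
  apply: le_lt_trans (set_mem (Lp_classP f)).
  apply: ae_le_Lnorm => //; try exact: measurable_modulus.
  apply: aeW => x /=; rewrite hE; case: ifP => // _.
  by rewrite (eqP (_ : modulus 0 == 0)) ?modulus_eq0 ?normr0.
by exists u; apply: filterS uE => x ->; rewrite hE.
Qed.

Lemma L1_norm_integral f :
  `|f| = mk_scalar s (fine (\int[mu]_x (modulus (f x))%:E)) 0.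
Proof. exact: L1_normE. Qed.

Lemma L1_integral_fin f : (\int[mu]_x (modulus (f x))%:E)%E \is a fin_num.
Proof.
have := set_mem (Lp_classP f); rewrite /= /Lp_enorm Lnorm1 => ffin.
rewrite ge0_fin_numE; last first.
  by apply: integral_ge0 => x _; rewrite lee_fin modulus_ge0.
apply: le_lt_trans ffin; rewrite le_eqVlt; apply/orP; left; apply/eqP.
by apply: eq_integral => x _ /=; rewrite ger0_norm ?modulus_ge0.
Qed.

Lemma modulus0 : modulus (0 : K) = 0.
Proof. by apply/eqP; rewrite modulus_eq0. Qed.

Lemma mk_scalar_modulus (a : K) (r : R) :
  mk_scalar s (modulus a * r) 0 = `|a| * mk_scalar s r 0.
Proof. by rewrite mk_scalarM modulusE. Qed.

Lemma l1_sum_disjoint u v :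
  (\forall x \ae mu, u x = 0 \/ v x = 0) -> l1_sum u v.
Proof.
move=> uv a b; rewrite !L1_norm_integral -!mk_scalar_modulus -mk_scalarD.
congr mk_scalar; apply: EFin_inj.
rewrite EFinD !EFinM !fineK ?L1_integral_fin//.
rewrite -!ge0_integralZl//=; try exact: measurable_modulus_ereal;
  try (by rewrite lee_fin modulus_ge0);
  try by move=> x _; rewrite lee_fin modulus_ge0.
rewrite -ge0_integralD//=; first last.
- by apply: emeasurable_funM => //; exact: measurable_modulus_ereal.
- by move=> x _; rewrite -EFinM lee_fin mulr_ge0 ?modulus_ge0.
- by apply: emeasurable_funM => //; exact: measurable_modulus_ereal.
- by move=> x _; rewrite -EFinM lee_fin mulr_ge0 ?modulus_ge0.
apply: ge0_ae_eq_integral => //=.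
- exact: measurable_modulus_ereal.
- by apply: emeasurable_funD => //; apply: emeasurable_funM => //;
    exact: measurable_modulus_ereal.
- by move=> x _; rewrite lee_fin modulus_ge0.
- by move=> x _; rewrite -!EFinM -EFinD lee_fin addr_ge0 ?mulr_ge0 ?modulus_ge0.
apply: filterS2 uv (Lp_repr_comb a b u v) => x /= uv0 -> _.
by case: uv0 => ->; rewrite modulus0 mule0 mulr0 ?add0r ?addr0 modulusM EFinM
  ?add0e ?adde0.
Qed.

Lemma L1_norm_eq (u v : L) :
  (\int[mu]_x (modulus (u x))%:E = \int[mu]_x (modulus (v x))%:E)%E <->
  `|u| = `|v|.
Proof.
rewrite !L1_norm_integral; split=> [-> //|/mk_scalar_inj uv].
by rewrite -(fineK (L1_integral_fin u)) -(fineK (L1_integral_fin v)) uv.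
Qed.

Lemma integral_modulus_restrict (f u : L) P : measurable P ->
  (\forall x \ae mu, u x = if x \in P then f x else 0) ->
  (\int[mu]_x (modulus (u x))%:E = \int[mu]_(x in P) (modulus (f x))%:E)%E.
Proof.
move=> mP uE; rewrite [RHS]integral_mkcond; apply: ge0_ae_eq_integral => //=.
- exact: measurable_modulus_ereal.
- by apply/measurable_restrict => //; exact: measurable_modulus_ereal.
- by move=> x _; rewrite lee_fin modulus_ge0.
- by move=> x _; rewrite /patch; case: ifP => // _; rewrite lee_fin modulus_ge0.
apply: filterS uE => x /= -> _; rewrite /patch; case: ifP => // _.
by rewrite modulus0.
Qed.

Lemma integral_modulus_const (f : L) P (c : K) : measurable P ->
  (\forall x \ae mu, P x -> f x = c) ->
  (\int[mu]_(x in P) (modulus (f x))%:E = mu P * (modulus c)%:E)%E.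
Proof.
move=> mP fc; rewrite muleC -integral_cst//.
apply: ge0_ae_eq_integral => //=.
- exact: measurable_modulus_ereal.
- by move=> x _; rewrite lee_fin modulus_ge0.
- by move=> x _; rewrite lee_fin modulus_ge0.
by apply: filterS fc => x fx Px; rewrite fx.
Qed.

Lemma scalar_measurable_mul (g h : mfunK X R s) :
  (fun x => g x * h x) \in @scalar_measurable _ X R s.
Proof.
have /set_mem[reg img] := mfunK_measurable g.
have /set_mem[reh imh] := mfunK_measurable h.
apply: mem_set; split.
  rewrite [X in measurable_fun _ X](_ : _ = fun x =>
    scalar_re (g x) * scalar_re (h x) - scalar_im (g x) * scalar_im (h x)).
    by apply: measurable_funB; exact: measurable_funM.
  apply/funext => x /=.
  by rewrite -[_ * _ in LHS]addr0 scalar_reP scalar_re0 addr0.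
rewrite [X in measurable_fun _ X](_ : _ = fun x =>
  scalar_re (g x) * scalar_im (h x) + scalar_im (g x) * scalar_re (h x)).
  by apply: measurable_funD; exact: measurable_funM.
apply/funext => x /=.
by rewrite -[_ * _ in LHS]addr0 scalar_imP scalar_im0 addr0.
Qed.

Lemma scalar_integral_ae0 (g : X -> K) : g \in @scalar_measurable _ X R s ->
  (\forall x \ae mu, g x = 0) -> scalar_integral mu g = 0.
Proof.
move=> /set_mem[reg img] g0; rewrite /scalar_integral /Rintegral.
rewrite (ae_eq_integral (cst 0%E)) ?integral0//; last 2 first.
- exact/measurable_EFinP.
- by apply: filterS g0 => x /= -> _; rewrite scalar_re0.
rewrite (ae_eq_integral (cst 0%E)) ?integral0/= ?mk_scalar0//.
- exact/measurable_EFinP.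
- by apply: filterS g0 => x /= -> _; rewrite scalar_im0.
Qed.

Lemma Linfty_indicator P : measurable P ->
  exists h : Linfty s mu, \forall x \ae mu, h x = if x \in P then 1 else 0.
Proof.
move=> mP.
have c1 : (fun=> 1) \in @scalar_measurable _ X R s.
  by apply: mem_set; split; exact: measurable_cst.
have [|u uE] := @Lp_intro +oo%E (leey 1%E) (MfunK c1).
  have m1 : modulus (1 : K) = 1.
    by apply: (@mk_scalar_inj R s); rewrite modulusE normr1; case: s.
  have -> : EFin \o (@modulus R s \o MfunK c1) = cst 1%E.
    by apply/funext => x /=; rewrite m1.
  rewrite unlock /Lnorm; case: ifPn => // mu0.
  rewrite (_ : abse \o _ = cst 1%E) ?ess_sup_cst ?ltry//.
  by apply/funext => x /=; rewrite normr1.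
have [h hE] := Lp_restrict u mP; exists h.
by apply: filterS2 hE uE => x -> ->.
Qed.

(** If every element of L1 vanished on [P], the indicator of [P] would induce
    the zero functional, hence be zero in Linfty by injectivity of the canonical
    map, and [P] would be null. *)
Lemma L1_dual_support P : L1_dual_is_Linfty s mu -> measurable P ->
  mu P <> 0%E -> exists z : L, z <> 0 /\ \forall x \ae mu, ~ P x -> z x = 0.
Proof.
move=> hdual mP muP; have inj : set_inj setT (@canonical_pairing _ X R s mu).
  by case: hdual => _ [].
apply: contrapT => noz; apply: muP.
have null v : \forall x \ae mu, P x -> v x = 0.
  have [z zE] := Lp_restrict v mP.
  suff /Lp_eq0P z0 : z = 0.
    by apply: filterS2 zE z0 => x -> + Px; rewrite mem_set.
  apply: contrapT => zn0; apply: noz; exists z; split=> //.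
  by apply: filterS zE => x -> nPx; rewrite memNset.
have [h hE] := Linfty_indicator mP.
have h0 : h = 0.
  apply: inj; rewrite ?inE//; apply/funext => v; rewrite /canonical_pairing.
  rewrite !scalar_integral_ae0//; try exact: scalar_measurable_mul.
    by apply: filterS (Lp_repr0 (leey 1%E)) => x ->; rewrite mul0r.
  apply: filterS2 hE (null v) => x -> vP; case: ifP => [/set_mem/vP ->|_].
    by rewrite mulr0.
  by rewrite mul0r.
move/Lp_eq0P : h0 => h0.
apply/negligibleP => //.
apply: negligibleS (_ : mu.-negligible (~` [set x | ~ P x])).
  by move=> x Px; apply.
apply: filterS2 hE h0 => x -> + /mem_set Px; rewrite Px => /eqP.
by rewrite oner_eq0.
Qed.

End L1_space.

(** * Measurable functions on atoms *)

Section atoms.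
Context d (X : measurableType d) (R : realType).
Variable mu : {measure set X -> \bar R}.
Implicit Types (A P : set X).

Lemma ae_exists A (Q : X -> Prop) : measurable A -> mu A <> 0%E ->
  (\forall x \ae mu, Q x) -> exists2 x, A x & Q x.
Proof.
move=> mA muA aeQ; apply: contrapT => noQ; apply: muA.
apply/negligibleP => //; apply: negligibleS aeQ => x Ax Qx.
by apply: noQ; exists x.
Qed.

Lemma ae_setC P : measurable P -> mu P = 0%E -> \forall x \ae mu, ~ P x.
Proof.
move=> mP /(negligibleP _ mP); apply: negligibleS => x /=.
by move/contrapT.
Qed.

Lemma atom_neq0 A : atom mu A -> mu A <> 0%E.
Proof. by case=> _ A0 _ eA; rewrite eA ltxx in A0. Qed.

Lemma atom_ae_decided A P : atom mu A -> measurable P ->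
  exists b : bool, \forall x \ae mu, A x -> (x \in P) = b.
Proof.
move=> [mA A0 atA] mP; have mAP : measurable (A `&` P) by exact: measurableI.
have [AP0|/eqP AP0] := eqVneq (mu (A `&` P)) 0%E.
  exists false; apply: filterS (ae_setC mAP AP0) => x nAP Ax.
  by apply: memNset => Px; exact: nAP.
exists true; have AP : (0 < mu (A `&` P))%E.
  by rewrite lt_def measure_ge0 andbT; apply/eqP.
have ADP := atA _ mAP (@subIsetl _ _ _) AP.
apply: filterS (ae_setC (measurableD mA mAP) ADP) => x nAP Ax.
by apply/mem_set; apply: contrapT => nPx; apply: nAP; split=> // -[_ /nPx].
Qed.

(** The countably many cuts [g < q], with [q] rational, have almost everywhere
    on [A] the same truth values as at one fixed point [x0], and these values
    determine a real number. *)
Lemma atom_ae_constR A (g : X -> R) : atom mu A -> measurable_fun setT g ->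
  exists c, \forall x \ae mu, A x -> g x = c.
Proof.
move=> atA mg; have [mA _ _] := atA.
pose cut (q : rat) := [set x | g x < ratr q].
have mcut q : measurable (cut q).
  have := mg measurableT _ (measurable_itv `]-oo, (ratr q : R)[).
  by rewrite setTI; congr measurable; apply/seteqP; split=> x /=;
    rewrite in_itv.
pose E n := cut (odflt 0 (unpickle n)).
have /choice[b bE] n :
    exists b : bool, \forall x \ae mu, A x -> (x \in E n) = b.
  by apply: atom_ae_decided => //; exact: mcut.
have aeE : \forall x \ae mu, forall n, A x -> (x \in E n) = b n.
  exact: ae_foralln.
have [x0 Ax0 x0E] := ae_exists mA (atom_neq0 atA) aeE.
exists (g x0); apply: filterS aeE => x xE Ax.
have same q : cut q x <-> cut q x0.
  have := xE (pickle q) Ax; rewrite -(x0E (pickle q) Ax0) /E pickleK /=.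
  by move=> e; split=> /mem_set; rewrite (e, esym e) => /set_mem.
apply/eqP; rewrite eq_le !leNgt; apply/andP; split; apply/negP.
  move=> /rat_in_itvoo[q]; rewrite in_itv/= => /andP[x0q qx].
  by have /same := x0q; rewrite /cut/= ltNge ltW.
move=> /rat_in_itvoo[q]; rewrite in_itv/= => /andP[xq qx0].
by have /same := xq; rewrite /cut/= ltNge ltW.
Qed.

Lemma atom_ae_const (s : scalar_kind) A (g : mfunK X R s) : atom mu A ->
  exists c : Defs.scalar R s, \forall x \ae mu, A x -> g x = c.
Proof.
move=> atA; have /set_mem[mre mim] := mfunK_measurable g.
have [a aE] := atom_ae_constR atA mre.
have [b bE] := atom_ae_constR atA mim.
have mk_reim (z : Defs.scalar R s) :
    mk_scalar s (scalar_re z) (scalar_im z) = z.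
  by case: s z {g mre mim aE bE} => // -[].
exists (mk_scalar s a b); apply: filterS2 aE bE => x gxa gxb Ax.
by rewrite -[LHS]mk_reim -gxa// -gxb.
Qed.
End atoms.

(** * Left-symmetric points of L1 *)

Section characterization.
Context d (X : measurableType d) (R : realType) (s : scalar_kind).
Variable mu : {measure set X -> \bar R}.
Local Notation K := (Defs.scalar R s).
Local Notation L := (L1 s mu).
Implicit Types (u v f : L) (A B E P : set X).
(** The value at [P] of the finite measure with density [|f|]. *)
Local Notation mass f P :=
  (\int[mu]_(x in P) (modulus (aeclass_repr (Lp_class f) x))%:E)%E.

Lemma L1_split f P : measurable P -> exists u v : L,
  [/\ f = u + v, l1_sum u v,
      \forall x \ae mu, u x = if x \in P then f x else 0 &
      \forall x \ae mu, v x = if x \in ~` P then f x else 0].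
Proof.
move=> mP; have [u uE] := Lp_restrict f mP.
have [v vE] := Lp_restrict f (measurableC mP).
exists u, v; split => //.
  apply/Lp_eqP; have uvE := Lp_repr_comb 1 1 u v; rewrite !scale1r in uvE.
  apply: filterS3 uE vE uvE => x ux vx ->; rewrite ux vx !mul1r in_setC.
  by case: ifP => _; rewrite ?addr0 ?add0r.
apply: l1_sum_disjoint; apply: filterS2 uE vE => x -> ->; rewrite in_setC.
by case: ifP => _; [right|left].
Qed.

Lemma mass_fin f P : measurable P -> mass f P \is a fin_num.
Proof.
move=> mP; have [u uE] := Lp_restrict f mP.
by rewrite -(integral_modulus_restrict mP uE) L1_integral_fin.
Qed.

Lemma massU f A B : measurable A -> measurable B -> A `&` B = set0 ->
  mass f (A `|` B) = (mass f A + mass f B)%E.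
Proof.
move=> mA mB AB; rewrite ge0_integral_setU//=.
- exact: measurable_modulus_ereal.
- by move=> x _; rewrite lee_fin modulus_ge0.
- exact/disj_set2P.
Qed.

Lemma mass_eq0 f P : measurable P -> (\forall x \ae mu, f x <> 0) ->
  mass f P = 0%E -> mu P = 0%E.
Proof.
move=> mP f0 fP0; apply: contrapT => muP.
have : (\int[mu]_(x in P) `|(modulus (f x))%:E| = 0)%E.
  rewrite -[RHS]fP0; apply: eq_integral => x _.
  by rewrite gee0_abs// lee_fin modulus_ge0.
have mfP := @measurable_modulus_ereal _ X R s (Lp_class f) P.
move/(ae_eq_integral_abs mu mP mfP) => fP.
have /= fP0' : \forall x \ae mu, P x -> (modulus (f x))%:E = 0%E by exact: fP.
have [x Px [fx /(_ Px) [/eqP]]] := ae_exists mP muP (filterI f0 fP0').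
by rewrite modulus_eq0 => /eqP.
Qed.

(** Otherwise the zero set of [f] carries some [z <> 0], whose support is
    disjoint from that of [f]. *)
Lemma left_symmetric_ae_neq0 f : L1_dual_is_Linfty s mu ->
  left_symmetric f -> f <> 0 -> \forall x \ae mu, f x <> 0.
Proof.
move=> hdual symf f0.
pose N := [set x | f x = 0].
have mN : measurable N.
  have := measurable_modulus (Lp_class f) measurableT (measurable_set1 (0 : R)).
  rewrite setTI; congr measurable; apply/seteqP; split=> x /=.
    by move/eqP; rewrite modulus_eq0 => /eqP.
  by move=> ->; rewrite modulus0.
apply: (@ae_setC _ _ _ _ N) => //; apply: contrapT => muN.
have [z [z0 zN]] := L1_dual_support hdual mN muN.
apply: f0; apply: (@left_symmetric_l1_sum_eq0 _ _ f z) => //; last exact/eqP.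
apply: l1_sum_disjoint; apply: filterS zN => x zx.
by have [fx0|/zx] := pselect (N x); [left|right].
Qed.

(** The restrictions of [f] to [E] and to its complement form an l1-sum, and
    they are nonzero because [f] vanishes almost nowhere. *)
Lemma left_symmetric_mass f E : left_symmetric f ->
  (\forall x \ae mu, f x <> 0) -> measurable E ->
  mu E <> 0%E -> mu (~` E) <> 0%E -> mass f E = mass f (~` E).
Proof.
move=> symf f0 mE muE muCE; have mCE := measurableC mE.
have [u [v [fE uv uE vE]]] := L1_split f mE.
rewrite -(integral_modulus_restrict mE uE) -(integral_modulus_restrict mCE vE).
have restr_neq0 P (w : L) : measurable P -> mu P <> 0%E ->
    (\forall x \ae mu, w x = if x \in P then f x else 0) -> w != 0.
  move=> mP muP wE; apply/eqP => /Lp_eq0P w0.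
  have [x Px [[fx wx]]] := ae_exists mP muP (filterI (filterI f0 wE) w0).
  by rewrite wx mem_set.
by apply/L1_norm_eq/left_symmetric_l1_sum; rewrite -?fE//;
  [exact: restr_neq0 uE|exact: restr_neq0 vE].
Qed.

(** If [C] is a non-null part of [E], then [C] balances the union of
    [E `\` C] and [~` E], while [~` E] balances the union of [C] and
    [E `\` C].  Comparing the two, [E `\` C] has mass 0. *)
Lemma left_symmetric_atom f E : left_symmetric f ->
  (\forall x \ae mu, f x <> 0) -> measurable E ->
  mu E <> 0%E -> mu (~` E) <> 0%E -> atom mu E.
Proof.
move=> symf f0 mE muE muCE; split=> //.
  by rewrite lt_def measure_ge0 andbT; apply/eqP.
move=> C mC CE C0; have mD : measurable (E `\` C) by exact: measurableD.
have muC : mu C <> 0%E by move=> e; rewrite e ltxx in C0.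
have muCC : mu (~` C) <> 0%E.
  move=> e; apply: muCE.
  by apply: subset_measure0 e; [exact: measurableC..|exact: subsetC].
apply: (mass_eq0 mD f0).
have := left_symmetric_mass symf f0 mC muC muCC.
have := left_symmetric_mass symf f0 mE muE muCE.
have mCE := measurableC mE.
have -> : ~` C = (E `\` C) `|` ~` E.
  apply/seteqP; split=> x /=; last by case=> [[]//|/[swap] /CE].
  by move=> nCx; have [Ex|nEx] := pselect (E x); [left|right].
rewrite massU//; last by rewrite setDE setIAC setICr set0I.
rewrite -{1}(setDUK CE) massU//; last exact: setDIK.
have fin P : measurable P -> exists r : R, mass f P = r%:E.
  by move=> mP; exists (fine (mass f P)); rewrite fineK// mass_fin.
have [c ->] := fin _ mC.
have [e ->] := fin _ mCE.
have [k ->] := fin _ mD.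
rewrite -!EFinD => -[ck] [cke]; congr EFin; lra.
Qed.

(** The whole space is an atom, so all elements of L1 are constants, hence
    multiples of [f] unless [f = 0]. *)
Lemma left_symmetric_trivial f :
  (forall E, measurable E -> mu E = 0%E \/ mu (~` E) = 0%E) ->
  left_symmetric f.
Proof.
move=> triv; have [->|/eqP f0] := eqVneq f 0; first exact: left_symmetric0.
have muT : mu setT <> 0%E.
  move=> muT; apply: f0; apply/Lp_eq0P.
  by apply: filterS (ae_setC measurableT muT) => x /(_ I).
have atT : atom mu setT.
  split=> //; first by rewrite lt_def measure_ge0 andbT; apply/eqP.
  move=> B mB _ B0; rewrite setTD; case: (triv B mB) => // e.
  by rewrite e ltxx in B0.
have [c cE] := atom_ae_const f atT.
have c0 : c != 0.
  apply/eqP => c0; apply: f0; apply/Lp_eq0P.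
  by apply: filterS cE => x ->.
apply: left_symmetric_line => y; have [b bE] := atom_ae_const y atT.
exists (b / c); apply/Lp_eqP.
have := Lp_repr_comb (b / c) 0 f f; rewrite scale0r addr0.
by apply: filterS3 cE bE => x -> // -> // ->; rewrite mul0r addr0 divfK.
Qed.

(** Unless [f = 0], its constant values on [A] and [B] are both nonzero, so
    the restrictions [u] and [v] of [f] to the atoms span L1; the hypothesis
    on the masses says [`|u| = `|v|]. *)
Lemma left_symmetric_two_atoms f A B : atom mu A -> atom mu B ->
  A `&` B = set0 -> A `|` B = setT ->
  (\forall x \ae mu, A x -> \forall y \ae mu, B y ->
     (mu A * (modulus (f x))%:E = mu B * (modulus (f y))%:E)%E) ->
  left_symmetric f.
Proof.
move=> atA atB AB0 ABT massAB.
have [->|/eqP f0] := eqVneq f 0; first exact: left_symmetric0.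
have [mA _ _] := atA; have [mB _ _] := atB.
have BE : B = ~` A.
  apply/seteqP; split=> x /=.
    by move=> Bx Ax; rewrite -[False]/(set0 x) -AB0.
  by have : setT x by []; rewrite -ABT => -[].
have [a aE] := atom_ae_const f atA.
have [b bE] := atom_ae_const f atB.
have ab : (mu A * (modulus a)%:E = mu B * (modulus b)%:E)%E.
  have [x Ax [fx /(_ Ax) xB]] :=
    ae_exists mA (atom_neq0 atA) (filterI aE massAB).
  have [y By [fy /(_ By)]] := ae_exists mB (atom_neq0 atB) (filterI bE xB).
  by rewrite fx// fy.
have [u [v [fE uv uE vE]]] := L1_split f mA.
rewrite -BE in vE.
have uvn : `|u| = `|v|.
  apply/L1_norm_eq; rewrite (integral_modulus_restrict mA uE).
  rewrite (integral_modulus_restrict mB vE).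
  by rewrite (integral_modulus_const mA aE) (integral_modulus_const mB bE).
have f00 : ~ (a = 0 /\ b = 0).
  case=> a0 b0; apply: f0; apply/Lp_eq0P; apply: filterS2 aE bE => x.
  by have : setT x by []; rewrite -ABT a0 b0 => -[Ax /(_ Ax)|Bx _ /(_ Bx)].
have modulus_mul0 P (c : K) :
    atom mu P -> (0 = mu P * (modulus c)%:E)%E -> c = 0.
  move=> atP /esym/eqP; rewrite mule_eq0 => /orP[/eqP/(atom_neq0 atP)//|].
  by rewrite eqe modulus_eq0 => /eqP.
have a0 : a != 0.
  apply/eqP => a0; apply: f00; split=> //; apply: modulus_mul0 atB _.
  by rewrite -ab a0 modulus0 mule0.
have b0 : b != 0.
  apply/eqP => b0; apply: f00; split=> //; apply: modulus_mul0 atA _.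
  by rewrite ab b0 modulus0 mule0.
rewrite fE; apply: left_symmetric_l1_span => //.
  exact: scalar_parallelogram.
move=> y; have [p pE] := atom_ae_const y atA.
have [q qE] := atom_ae_const y atB.
exists (p / a), (q / b); apply/Lp_eqP.
have comb := Lp_repr_comb (p / a) (q / b) u v.
apply: filterS3 (filterI aE bE) (filterI uE vE) (filterI comb (filterI pE qE)).
move=> x [fa fb] [ux vx] [-> [yp yq]]; rewrite ux vx BE in_setC.
have [xA|xA] := boolP (x \in A).
  by have Ax := set_mem xA; rewrite mulr0 addr0 yp// fa// divfK.
have Bx : B x by rewrite BE => /mem_set; exact/negP.
by rewrite mulr0 add0r yq// fb// divfK.
Qed.

Lemma left_symmetric_two_atoms_ex f E : L1_dual_is_Linfty s mu ->
  left_symmetric f -> f <> 0 -> measurable E ->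
  mu E <> 0%E -> mu (~` E) <> 0%E ->
  exists A B : set X,
    [/\ atom mu A, atom mu B, A `&` B = set0, A `|` B = setT &
        \forall x \ae mu, A x -> \forall y \ae mu, B y ->
          (mu A * (modulus (f x))%:E = mu B * (modulus (f y))%:E)%E].
Proof.
move=> hdual symf f0 mE muE muCE; have mCE := measurableC mE.
have aef0 := left_symmetric_ae_neq0 hdual symf f0.
have atE := left_symmetric_atom symf aef0 mE muE muCE.
have atCE : atom mu (~` E).
  by apply: (left_symmetric_atom symf aef0 mCE muCE); rewrite setCK.
exists E, (~` E); split => //; [exact: setICr|exact: setUCr|].
have [a aE] := atom_ae_const f atE.
have [b bE] := atom_ae_const f atCE.
have := left_symmetric_mass symf aef0 mE muE muCE.
rewrite (integral_modulus_const mE aE) (integral_modulus_const mCE bE) => ab.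
apply: filterS aE => x fx Ex; apply: filterS bE => y fy Ey.
by rewrite fx// fy.
Qed.

End characterization.

Theorem theorem3p0p4 (R : realType) (s : scalar_kind)
    (d : measure_display) (X : measurableType d)
    (lambda : {measure set X -> \bar R})
    (hdual : L1_dual_is_Linfty s lambda) (f : L1 s lambda) :
  left_symmetric f <->
  exactly_one
    (\forall x \ae lambda, f x = 0)
    (~ (\forall x \ae lambda, f x = 0) /\
     forall E : set X, measurable E -> lambda E = 0%E \/ lambda (~` E) = 0%E)
    (~ (\forall x \ae lambda, f x = 0) /\
     exists A B : set X,
       [/\ atom lambda A, atom lambda B, A `&` B = set0, A `|` B = setT &
           \forall x \ae lambda, A x -> \forall y \ae lambda, B y ->
             (lambda A * (modulus (f x))%:E = lambda B * (modulus (f y))%:E)%E]).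
Proof.
have [/Lp_eq0P f0|f0] := pselect (\forall x \ae lambda, f x = 0).
  split=> [_|_]; last by rewrite f0; exact: left_symmetric0.
  by apply: Or31; split; [exact/Lp_eq0P|case=> + _; apply; exact/Lp_eq0P..].
split=> [symf|[[/f0//]|[_ [_ triv] _]|[_ _ [_ [A [B [atA atB AB ABT fAB]]]]]]].
- have [triv|] := pselect (forall E : set X, measurable E ->
      lambda E = 0%E \/ lambda (~` E) = 0%E).
    apply: Or32; split=> // -[_ [A [B [atA atB AB _ _]]]].
    have [mA _ _] := atA; have [mB _ _] := atB.
    have [/(atom_neq0 atA)//|CA0] := triv A mA; apply: (atom_neq0 atB).
    apply: subset_measure0 CA0 => //; first exact: measurableC.
    by move=> x Bx Ax; rewrite -[False]/(set0 x) -AB.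
  move=> /existsNP[E /not_implyP[mE /not_orP[muE muCE]]].
  apply: Or33; split=> //; first by case=> _ /(_ E mE)[].
  split=> //; apply: left_symmetric_two_atoms_ex mE muE muCE => //.
  by move=> /Lp_eq0P.
- exact: left_symmetric_trivial.
- exact: left_symmetric_two_atoms atA atB AB ABT fAB.
Qed.
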